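(* Let $X$ be a non-trivial real Hausdorff locally convex space. If, for every nonempty closed convex $C\subset X$, the normal cone $N_C$ is maximal monotone, then, for every closed convex $C\subset X$, $\operatorname{Supp}C$ is dense in the boundary $\operatorname{bd}C$ of $C$.
   Context: $X^*$ is the topological dual of $X$ and $\langle x,x^*\rangle:=x^*(x)$. For $T:X\rightrightarrows X^*$, $\operatorname{Graph}T=\{(x,x^* )\in X\times X^*\mid x^*\in T(x)\}$; $T$ is monotone if $\langle x_1-x_2,x_1^*-x_2^*\rangle\ge 0$ for all $(x_1,x_1^* ),(x_2,x_2^* )\in\operatorname{Graph}T$, and maximal monotone if it is monotone and its graph is not properly contained in the graph of another monotone operator from $X$ to $X^*$. For $C\subset X$, the normal cone $N_C:X\rightrightarrows X^*$ is $N_C(a)=\{a^*\in X^*\mid \langle y-a,a^*\rangle\le 0\ \forall y\in C\}$ if $a\in C$ and $N_C(a)=\emptyset$ if $a\notin C$. The set of support points of $C$ is $\operatorname{Supp}C=\{x\in C\mid N_C(x)\ne\{0\}\}$. $\operatorname{bd}C$ is the topological boundary. *)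

(* Defs.v *)
From HB Require Import structures.
From mathcomp Require Import all_boot all_order all_algebra.
From mathcomp Require Import all_classical all_reals all_analysis.

Set Implicit Arguments.
Unset Strict Implicit.
Unset Printing Implicit Defensive.

Import Order.TTheory GRing.Theory Num.Theory.
Import numFieldNormedType.Exports.

Local Open Scope classical_set_scope.
Local Open Scope ring_scope.

Section dual.
Context (R : realType) (X : tvsType R).

Definition continuous_scalar : {pred X -> R} :=
  mem [set f : X -> R | scalar f /\ continuous f].

Fact continuous_scalar_zmod_closed : zmod_closed continuous_scalar.
Proof.
split=> [|f g]; rewrite !inE /=.
- by split=> [a x y /=|x]; [rewrite mulr0 addr0 | exact: cvg_cst].
- move=> [lf cf] [lg cg]; split=> [a x y|x].
  + by rewrite !fctE lf lg mulrBr opprD addrACA.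
  + by apply: cvgB; [exact: cf | exact: cg].
Qed.

HB.instance Definition _ :=
  GRing.isZmodClosed.Build (X -> R) continuous_scalar
    continuous_scalar_zmod_closed.

(* The zmodType structure is the pointwise one of X -> R; no topology is put on
   the dual. *)
Record topological_dual := Dual {
  dual_fun :> X -> R ;
  _ : dual_fun \in continuous_scalar }.

HB.instance Definition _ := [isSub for dual_fun].
HB.instance Definition _ := [Choice of topological_dual by <:].
HB.instance Definition _ := [SubChoice_isSubZmodule of topological_dual by <:].

End dual.

Section monotone_operators.
Context (R : realType) (X : tvsType R).

Implicit Types (T S : X -> set (topological_dual X)) (C : set X).

Definition graph T : set (X * topological_dual X) := [set p | T p.1 p.2].

Definition monotone_op T := forall p q : X * topological_dual X,
  graph T p -> graph T q -> 0 <= (p.2 - q.2) (p.1 - q.1).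

Definition maximal_monotone_op T :=
  monotone_op T /\ forall S, monotone_op S -> ~ (graph T `<` graph S).

Definition normal_cone C (a : X) : set (topological_dual X) :=
  [set f : topological_dual X | C a /\ forall y, C y -> f (y - a) <= 0].

Definition support_points C : set X :=
  [set x | C x /\ normal_cone C x <> [set 0]].

End monotone_operators.

Definition boundary (T : topologicalType) (A : set T) : set T :=
  closure A `\` interior A.

Definition dense_in (T : topologicalType) (A B : set T) :=
  A `<=` B /\ B `<=` closure A.

(* Main.v *)
Require Import Defs.
From HB Require Import structures.
From mathcomp Require Import all_boot all_order all_algebra.
From mathcomp Require Import all_classical all_reals all_analysis.
From mathcomp Require Import lra.
Import Order.TTheory GRing.Theory Num.Theory.
Import numFieldNormedType.Exports.
Local Open Scope classical_set_scope.
Local Open Scope ring_scope.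

(** The argument is by contradiction.  Let x0 be a boundary point of C with a
    neighbourhood B free of support points, and truncate: choose an open convex
    V around x0 whose closure lies in B, and put D = C `&` closure V.  As x0 is
    not interior to C, there is a point y of V outside C, hence outside D.
    The normal cone of D is maximal monotone, so (y, 0) cannot be monotonically
    related to all of its graph ([maximal_normal_cone]): some f in N_D(a), with
    a in D, satisfies f a < f y.

    It remains to turn this normal to D at a into a nonzero normal to C at the
    same point ([support_point_of_truncation]).  The set
    W = V `&` {x | f a < f x} is open and convex; it contains y, misses C since
    f <= f a on D, and has a in its closure, because moving from a towards y
    increases f.  A nonzero continuous functional g separating C from W
    therefore satisfies g c <= g a for all c in C: it is a nonzero element of
    N_C(a).  So a is a support point of C lying in B, a contradiction.

    The separation theorem ([convex_separation]) is obtained from convex cones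
    that avoid 0.  The positive multiples of W - C form such a cone; Zorn's
    lemma enlarges it to a maximal one, and maximality forces every nonzero
    vector or its opposite to belong to it ([total_cone_extension]).  Such a
    cone P is the positive side of a hyperplane up to lexicographic terms, and
    g x = sup {t | x - t w \in P}, for a fixed w in W - C, is the functional
    vanishing on that hyperplane ([total_cone_functional]).  It is continuous
    because it is bounded below on a neighbourhood of 0. *)

Set Implicit Arguments.
Unset Strict Implicit.

(** * Blunt convex cones and linear functionals *)

Section cones.
Context (R : realType) (X : lmodType R).
Implicit Types (P A : set X) (x y w : X) (s t : R).

Record blunt_cone P : Prop := BluntCone {
  cone_add : forall x y, P x -> P y -> P (x + y) ;
  cone_scale : forall t x, 0 < t -> P x -> P (t *: x) ;
  cone_blunt : ~ P 0 }.

Definition total_cone P := forall x, x <> 0 -> P x \/ P (- x).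

(** Zorn's lemma for inclusion also quantifies over the empty chain, whose union
    is not a cone containing P0; the sets A such that P0 `|` A is a blunt cone
    are stable under all unions of chains. *)
Lemma maximal_blunt_cone P0 : blunt_cone P0 ->
  exists P, [/\ blunt_cone P, P0 `<=` P
    & forall Q, blunt_cone Q -> P `<=` Q -> Q `<=` P].
Proof.
move=> cP0.
have [F FQ totF|A [cA maxA]] :=
    @Zorn_bigcup X [set A | blunt_cone (P0 `|` A)].
  have lift x y : (P0 `|` \bigcup_(A in F) A) x ->
      (P0 `|` \bigcup_(A in F) A) y ->
      exists Q, [/\ blunt_cone Q, Q x, Q y &
        Q `<=` P0 `|` \bigcup_(A in F) A].
    have sub A : F A -> P0 `|` A `<=` P0 `|` \bigcup_(A in F) A.
      by move=> FA z [|Az]; [left | right; exists A].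
    move=> [P0x|[A FA Ax]] [P0y|[B FB By]].
    - by exists P0; split=> //; exact: subsetUl.
    - exists (P0 `|` B); split; [exact: FQ|by left|by right|exact: sub].
    - exists (P0 `|` A); split; [exact: FQ|by right|by left|exact: sub].
    - have [AB|BA] := totF _ _ FA FB.
      + exists (P0 `|` B); split; [exact: FQ| |by right|exact: sub].
        by right; exact: AB.
      + exists (P0 `|` A); split; [exact: FQ|by right| |exact: sub].
        by right; exact: BA.
  split=> [x y /lift/[apply] -[Q [cQ Qx Qy QF]]|t x t0 Px|P00].
  - exact/QF/(cone_add cQ).
  - have [Q [cQ Qx _ QF]] := lift _ _ Px Px.
    exact/QF/(cone_scale cQ).
  - by have [Q [cQ Q0 _ _]] := lift _ _ P00 P00; exact: (cone_blunt cQ).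
exists (P0 `|` A); split=> // Q cQ AQ x Qx; apply: contrapT => nAx.
apply: (maxA Q); last by rewrite /= setUidr// => z P0z; apply: AQ; left.
split=> [|QA]; first by move=> z Az; apply: AQ; right.
by apply: nAx; right; exact: QA.
Qed.

(** If neither x nor - x lies in a maximal blunt cone P, then P together with
    all the p + s x, where s > 0 and p is in P or zero, is a strictly larger
    blunt cone: p + s x = 0 with s > 0 would put - x in P. *)
Lemma total_cone_extension P0 : blunt_cone P0 ->
  exists P, [/\ blunt_cone P, P0 `<=` P & total_cone P].
Proof.
move=> /maximal_blunt_cone[P [cP P0P maxP]]; exists P; split=> // x x0.
apply: contrapT => /not_orP[nPx nPNx]; apply: nPx.
(* The cone spanned by P and x, without 0: the last disjunction rules out the
   trivial combination p = 0, s = 0. *)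
pose Q := [set z | exists2 p, P p \/ p = 0 &
  exists2 s, 0 <= s & z = p + s *: x /\ (P p \/ 0 < s)].
apply: (maxP Q); last 2 first.
- move=> z Pz; exists z; first by left.
  by exists 0 => //; rewrite scale0r addr0; split; [|left].
- exists 0; first by right.
  by exists 1 => //; rewrite scale1r add0r; split; [|right].
split=> [_ _ [p Pp [s s0 [-> sp]]] [q Pq [t t0 [-> tq]]]
        |t _ t0 [p Pp [s s0 [-> sp]]]|[p Pp [s s0 [e sp]]]].
- exists (p + q).
    case: Pp Pq => [Pp|->] [Pq|->]; rewrite ?addr0 ?add0r; auto.
    by left; exact: cone_add.
  exists (s + t); first exact: addr_ge0.
  rewrite scalerDl addrACA; split=> //.
  case: sp tq => [{}Pp|s1] tq; last by right; lra.
  case: Pq => [Pq|->]; first by left; exact: cone_add.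
  by left; rewrite addr0.
- exists (t *: p).
    by case: Pp => [Pp|->]; [left; exact: cone_scale|right; rewrite scaler0].
  exists (t * s); first by rewrite mulr_ge0// ltW.
  rewrite scalerDr scalerA; split=> //.
  by case: sp => [?|?]; [left; exact: cone_scale|right; exact: mulr_gt0].
- have {}e : p = - (s *: x) by apply/eqP; rewrite -addr_eq0 -e.
  move: s0; rewrite le_eqVlt => /predU1P[s0|s0].
    case: sp => [{}Pp|]; last by rewrite -s0 ltxx.
    by apply: (cone_blunt cP); move: Pp; rewrite e -s0 scale0r oppr0.
  case: Pp => [Pp|p0].
    apply: nPNx; have : P (s^-1 *: p) by apply: cone_scale; rewrite ?invr_gt0.
    by rewrite e scalerN scalerA mulVf ?scale1r// gt_eqF.
  move/eqP: e; rewrite p0 eq_sym oppr_eq0 scaler_eq0 gt_eqF//=.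
  by move=> /eqP; exact: x0.
Qed.

(** The functional is g x = sup {t | x - t w \in P}, the height of x in the
    direction w.  Closure of P under addition makes g superadditive; totality
    of P gives g (- x) = - g x, hence additivity.  The last hypothesis says
    that w absorbs every direction, which keeps the supremum finite. *)
Lemma total_cone_functional P w : blunt_cone P -> total_cone P -> P w ->
  (forall x, exists t, P (t *: w - x)) ->
  exists g : X -> R, [/\ scalar g, g w = 1 & forall x, P x -> 0 <= g x].
Proof.
move=> cP totP Pw absw.
pose L x := [set t | P (x - t *: w)].
pose g x := sup (L x).
have Pws s : P (s *: w) -> 0 < s.
  move=> Psw; rewrite ltNge; apply/negP; rewrite le_eqVlt => /predU1P[s0|s0].
    by apply: (cone_blunt cP); rewrite -(scale0r w) -s0.
  apply: (cone_blunt cP); rewrite -(subrr (s *: w)); apply: cone_add => //.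
  by rewrite -scaleNr; apply: cone_scale => //; rewrite oppr_gt0.
have Llow x s t : s < t -> L x t -> L x s.
  move=> st Lt; rewrite /L/=.
  have -> : x - s *: w = (x - t *: w) + (t - s) *: w.
    by rewrite scalerBl addrA subrK.
  by apply: cone_add => //; apply: cone_scale => //; rewrite subr_gt0.
have L0 x : L x !=set0.
  have [t] := absw (- x); rewrite opprK => Pt; exists (- t).
  by rewrite /L/= scaleNr opprK addrC.
have Lub x : has_ubound (L x).
  have [t Pt] := absw x; exists t => s Ls.
  apply/ltW; rewrite -subr_gt0; apply: Pws.
  have -> : (t - s) *: w = (t *: w - x) + (x - s *: w).
    by rewrite scalerBl addrA subrK.
  exact: cone_add.
have Lg x t : L x t -> t <= g x by exact: ub_le_sup.
have gL x t : t < g x -> L x t.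
  move=> tg; have : 0 < g x - t by rewrite subr_gt0.
  move=> /(@sup_adherent _ (L x)) []; first by split.
  by move=> s Ls; rewrite subKr => /Llow; exact.
have gsw s : g (s *: w) = s.
  apply/eqP; rewrite eq_le; apply/andP; split; rewrite leNgt; apply/negP => h.
    by have := gL _ _ h; rewrite /L/= subrr; exact: (cone_blunt cP).
  have : L (s *: w) ((s + g (s *: w)) / 2).
    by rewrite /L/= -scalerBl; apply: cone_scale => //; lra.
  by move=> /Lg; lra.
have g0 : g 0 = 0 by rewrite -(scale0r w) gsw.
have gsup x y : g x + g y <= g (x + y).
  rewrite leNgt; apply/negP => h.
  (* A third of the excess, so that the loss 2 d stays below it. *)
  pose d := (g x + g y - g (x + y)) / 3.
  have Lx : L x (g x - d) by apply: gL; rewrite /d; lra.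
  have Ly : L y (g y - d) by apply: gL; rewrite /d; lra.
  have : L (x + y) (g x - d + (g y - d)).
    by rewrite /L/= scalerDl opprD addrACA; exact: cone_add.
  by move=> /Lg; rewrite /d; lra.
have gN x : g (- x) = - g x.
  apply/eqP; rewrite eq_le; apply/andP; split.
    by have := gsup x (- x); rewrite subrr g0; lra.
  rewrite leNgt; apply/negP => h.
  (* The midpoint of the gap, g x < t < - g (- x): x - t w is then on neither
     side of P. *)
  pose t := (g x - g (- x)) / 2.
  have [xt|nxt] := pselect (x - t *: w = 0).
    have : g x = t by rewrite -(gsw t); congr g; apply/subr0_eq.
    by rewrite /t; lra.
  have [/Lg|] := totP _ nxt; first by rewrite /t; lra.
  rewrite opprB => Pt; have : L (- x) (- t) by rewrite /L/= scaleNr opprK addrC.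
  by move=> /Lg; rewrite /t; lra.
have gD x y : g (x + y) = g x + g y.
  apply/eqP; rewrite eq_le gsup andbT.
  by have := gsup (- x) (- y); rewrite -opprD !gN; lra.
have gZle a x : 0 < a -> a * g x <= g (a *: x).
  move=> a0; rewrite leNgt; apply/negP => h.
  have Lx : L x ((g (a *: x) + a * g x) / 2 / a).
    by apply: gL; rewrite ltr_pdivrMr//; lra.
  suff /Lg : L (a *: x) ((g (a *: x) + a * g x) / 2) by lra.
  rewrite /L/=; have := cone_scale cP a0 Lx.
  by rewrite scalerBr scalerA [a * (_ / a)]mulrC divfK// gt_eqF.
have gZ a x : 0 < a -> g (a *: x) = a * g x.
  move=> a0; apply/eqP; rewrite eq_le gZle// andbT.
  by have := gZle _ (- x) a0; rewrite scalerN !gN; lra.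
exists g; split=> [a x y||x Px].
- rewrite gD; congr (_ + _); have [a0|a0|->] := ltgtP a 0.
  + by rewrite -[a *: x]opprK gN -scaleNr gZ ?oppr_gt0// mulNr opprK.
  + exact: gZ.
  + by rewrite scale0r g0 mul0r.
- by rewrite -[w]scale1r gsw.
- by apply: Lg; rewrite /L/= scale0r subr0.
Qed.

End cones.

(** * Functionals and convex sets in a locally convex space *)

Section locally_convex.
Context (R : realType) (X : tvsType R).
Implicit Types (A C W U V : set X) (a c x y : X) (f g : topological_dual X).

Lemma convex_setP A : convex_set A <->
  forall x y (t : R), 0 < t -> t < 1 -> A x -> A y ->
    A (t *: x + (1 - t) *: y).
Proof.
split=> [cA x y t t0 t1 Ax Ay|cA].
  have := cA x y (Itv01 (ltW t0) (ltW t1)) (mem_set Ax) (mem_set Ay).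
  by rewrite inE.
apply/convex_setW => x y /set_mem Ax /set_mem Ay k k0 k1; apply/mem_set.
exact: cA.
Qed.

Lemma dualP f : scalar f /\ continuous f.
Proof. by have := valP f; rewrite inE. Qed.

Lemma dualB f x y : f (x - y) = f x - f y.
Proof. by have [lf _] := dualP f; rewrite addrC -scaleN1r lf; lra. Qed.

Lemma dual_comb f s t x y : f (s *: x + t *: y) = s * f x + t * f y.
Proof.
have [lf _] := dualP f; rewrite lf; congr (_ + _).
have f0 : f 0 = 0 by rewrite -(subrr x) dualB subrr.
by rewrite -[t *: y]addr0 lf f0 addr0.
Qed.

Lemma dual_ray f s x y : f (x + s *: y) = f x + s * f y.
Proof. by rewrite -{1}[x]scale1r dual_comb mul1r. Qed.

Lemma cvg_combination (T : Type) (F : set_system T) {FF : Filter F}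
    (j k : T -> R^o) (u v : T -> X) (s t : R^o) x y :
  j @ F --> s -> k @ F --> t -> u @ F --> x -> v @ F --> y ->
  (fun i => j i *: u i + k i *: v i) @ F --> s *: x + t *: y.
Proof.
have cvgZ' (k' : T -> R^o) (u' : T -> X) (r : R^o) z :
    k' @ F --> r -> u' @ F --> z -> (fun i => k' i *: u' i) @ F --> r *: z.
  move=> kr uz.
  apply: (@continuous2_cvg _ R^o X X _ _ _ _ (fun p q => p *: q) r z) => //.
  exact: (@scale_continuous R X (r, z)).
move=> js kt ux vy.
apply: (@continuous2_cvg _ X X X _ _ _ _ +%R (s *: x) (t *: y)).
- exact: (@tvs.add_continuous X (s *: x, t *: y)).
- exact: cvgZ'.
- exact: cvgZ'.
Qed.

Lemma cvg_ray a x : (fun s : R^o => a + s *: x) @ (0 : R^o) --> a.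
Proof.
have : (fun s : R^o => (1 : R^o) *: a + s *: x) @ (0 : R^o) -->
    (1 : R^o) *: a + (0 : R^o) *: x.
  by apply: (cvg_combination (j := fun=> 1) (k := id) (u := fun=> a)
    (v := fun=> x)); [exact: cvg_cst|exact: cvg_id|exact: cvg_cst..].
by rewrite scale1r scale0r addr0.
Qed.

Lemma nbhs_ray {a U} x : nbhs a U ->
  exists s : R, [/\ 0 < s, s < 1 & U (a + s *: x)].
Proof.
move=> Ua; have /nbhs_ballP[e /= e0 eU] := @cvg_ray a x _ Ua.
exists (Num.min (e / 2) (1 / 2)).
have s0 : 0 < Num.min (e / 2) (1 / 2) by rewrite lt_min; apply/andP; split; lra.
split=> //; first by rewrite gt_min; apply/orP; right; lra.
apply: eU; rewrite /ball/= sub0r normrN gtr0_norm//.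
by rewrite gt_min; apply/orP; left; lra.
Qed.

Lemma convex_closure A : convex_set A -> convex_set (closure A).
Proof.
move=> /convex_setP cA; apply/convex_setP => x y t t0 t1 clx cly B.
have : (fun z : X * X => (t : R^o) *: z.1 + (1 - t : R^o) *: z.2)
    @ nbhs (x, y) --> (t : R^o) *: x + (1 - t : R^o) *: y.
  by apply: (cvg_combination (j := fun=> t) (k := fun=> 1 - t) (u := fst)
    (v := snd)); [exact: cvg_cst|exact: cvg_cst|exact: cvg_fst|exact: cvg_snd].
move=> /[apply] -[[B1 B2] /= [/clx[u [Au B1u]] /cly[v [Av B2v]]] sB].
exists (t *: u + (1 - t) *: v); split; first exact: cA.
exact: (sB (u, v)).
Qed.

Lemma open_convex_nbhs x U : nbhs x U ->
  exists V, [/\ open V, convex_set V, V x & closure V `<=` U].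
Proof.
move=> /(@uniform_regular X x)[U' U'x clU'U].
have [B cB [oB Bx]] := @locally_convex R X.
have [V [BV Vx] VU'] := Bx x _ U'x.
exists V; split=> //; [exact: oB|by apply: cB; rewrite inE|].
exact: subset_trans (closureS VU') clU'U.
Qed.

(** A one-sided bound suffices: on the symmetric neighbourhood U `&` - U it
    bounds |g| by 1, and hence |g| by e on its dilation by e. *)
Lemma scalar_continuous (g : X -> R) U : scalar g -> nbhs 0 U ->
  (forall u, U u -> -1 <= g u) -> continuous g.
Proof.
move=> lg U0 gU x; apply/cvgrPdist_le => /= e e0.
have gN u : g (- u) = - g u.
  have g0 : g 0 = 0 by have := lg (-1) 0 0; rewrite scaler0 addr0; lra.
  by rewrite -[- u]addr0 -scaleN1r lg g0; lra.
have V0 : nbhs 0 (U `&` (-%R @` U)) by apply: filterI => //; exact: nbhs0N.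
have := nbhsT x (nbhs0Z (lt0r_neq0 e0) V0).
apply: filterS => _ [_ [u [Uu [v Uv vu]] <-] <-].
have -> : g x - g (x + e *: u) = - (e * g u).
  by rewrite addrC [x + _]addrC lg opprD subrK.
have gu1 := gU _ Uu; have gv1 := gU _ Uv.
have gu2 : g u <= 1 by rewrite -vu gN; lra.
by rewrite normrN ler_norml; apply/andP; split; nra.
Qed.

(** Openness of W is used twice: it makes a point w0 - c0 of W - C absorb every
    direction, and it bounds the functional below on the neighbourhood W - w0
    of 0. *)
Lemma convex_separation W C : open W -> convex_set W -> convex_set C ->
  W !=set0 -> C !=set0 -> W `&` C = set0 ->
  exists2 g : topological_dual X, g <> 0 & forall c x, C c -> W x -> g c <= g x.
Proof.
move=> oW /convex_setP cW /convex_setP cC [w0 Ww0] [c0 Cc0] WC0.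
pose P0 := [set z | exists (t : R) (w c : X),
  [/\ 0 < t, W w, C c & z = t *: (w - c)]].
have cP0 : blunt_cone P0.
  split=> [_ _ [t [w [c [t0 Ww Cc ->]]]] [t' [w' [c' [t'0 Ww' Cc' ->]]]]
          |s _ s0 [t [w [c [t0 Ww Cc ->]]]]|[t [w [c [t0 Ww Cc]]]]].
  - have tt : t + t' != 0 by rewrite gt_eqF// addr_gt0.
    have k0 : 0 < t / (t + t') by rewrite divr_gt0// addr_gt0.
    have k1 : t / (t + t') < 1 by rewrite ltr_pdivrMr ?addr_gt0// mul1r; lra.
    exists (t + t'), (t / (t + t') *: w + (1 - t / (t + t')) *: w'),
      (t / (t + t') *: c + (1 - t / (t + t')) *: c').
    split; [exact: addr_gt0|exact: cW|exact: cC|].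
    have e : (t + t') * (t / (t + t')) = t by rewrite mulrC divfK.
    rewrite opprD addrACA -!scalerBr [RHS]scalerDr !scalerA e mulrBr mulr1 e.
    by rewrite [t + t' - t]addrC addKr.
  - by exists (s * t), w, c; split; rewrite -?scalerA// mulr_gt0.
  - move=> /esym/eqP; rewrite scaler_eq0 gt_eqF//= subr_eq0 => /eqP wc.
    suff : (W `&` C) w by rewrite WC0.
    by split=> //; rewrite wc.
have [P [cP P0P totP]] := total_cone_extension cP0.
have PWC w c : W w -> C c -> P (w - c).
  by move=> Ww Cc; apply: P0P; exists 1, w, c; rewrite scale1r.
have W0 : nbhs w0 W by exact: open_nbhs_nbhs.
have [x|g [lg g1 gP]] :=
    total_cone_functional cP totP (PWC _ _ Ww0 Cc0).
  have [s [s0 _ Ws]] := nbhs_ray (- x) W0.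
  exists s^-1; have := @cone_scale _ _ _ cP s^-1 _ _ (PWC _ _ Ws Cc0).
  rewrite invr_gt0 => /(_ s0).
  by rewrite addrAC scalerDr scalerA mulVf ?gt_eqF// scale1r.
have cg : continuous g.
  apply: (@scalar_continuous g (+%R (- w0) @` W)) => //.
    by have := nbhsB (- w0) W0; rewrite addNr.
  move=> _ [w Ww <-]; have := gP _ (PWC _ _ Ww Cc0).
  have -> : w - c0 = 1 *: (- w0 + w) + (w0 - c0).
    by rewrite scale1r [- w0 + w]addrC addrA subrK.
  by rewrite lg g1; lra.
have gdual : g \in @continuous_scalar R X by rewrite inE.
exists (Dual gdual).
  move=> /(congr1 (fun f : topological_dual X => f (w0 - c0))) /=.
  by rewrite g1 => /eqP; rewrite oner_eq0.
by move=> c w Cc Ww; rewrite -subr_ge0 -dualB; exact/gP/PWC.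
Qed.

(** * Normal cones and support points *)

Lemma support_pointsP C x : support_points C x <->
  exists2 g : topological_dual X, g <> 0 & normal_cone C x g.
Proof.
split=> [[Cx nN]|[g g0 Nx]]; last first.
  split; first by have [] := Nx.
  by move=> N0; apply: g0; move: Nx; rewrite N0.
apply: contrapT => h; apply: nN; apply/seteqP; split=> [g Ng|_ ->] /=.
  by apply: contrapT => g0; apply: h; exists g.
by split.
Qed.

(** At an interior point, a normal functional is nonpositive in every direction,
    hence zero. *)
Lemma support_points_boundary C : support_points C `<=` boundary C.
Proof.
move=> x /support_pointsP[g g0 [Cx Ng]]; split; first exact: subset_closure.
move=> Cx'; apply: g0; apply/val_inj/funext => v /=.
have le0 u : g u <= 0.
  have [s [s0 _ /Ng]] := nbhs_ray u Cx'.
  by rewrite dualB dual_ray; nra.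
rewrite [RHS](_ : _ = 0)//; apply/eqP; rewrite eq_le le0/=.
by have := le0 (- v); rewrite -[- v]add0r dualB -(subrr v) !dualB; lra.
Qed.

(** Otherwise the pair (x, 0) could be added to the graph of the normal cone
    without losing monotonicity. *)
Lemma maximal_normal_cone C x : maximal_monotone_op (normal_cone C) -> ~ C x ->
  exists a f, normal_cone C a f /\ f a < f x.
Proof.
move=> [monN maxN] nCx; apply: contrapT => h.
have le a f : normal_cone C a f -> f x <= f a.
  by move=> Nf; rewrite leNgt; apply/negP => fa; apply: h; exists a, f.
pose S z : set (topological_dual X) :=
  [set f | normal_cone C z f \/ z = x /\ f = 0].
apply: (maxN S).
  move=> [a f] [b g] /= [Nf|[/= -> ->]] [Ng|[/= -> ->]].
  - exact: (monN (a, f) (b, g)).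
  - by rewrite subr0 dualB subr_ge0; exact: le.
  - rewrite sub0r; change (0 <= - g (x - b)).
    by rewrite dualB oppr_ge0 subr_le0; exact: le.
  - by rewrite subrr.
split; first by move=> p Np; left.
by move=> /(_ (x, 0)) [|Cx _]; [right|exact: nCx].
Qed.

(** A normal f to the truncated set at a which increases towards a point of V
    produces a nonzero normal to C itself: the part of V where f exceeds f a is
    an open convex set disjoint from C and touching it at a, and any functional
    separating the two supports C at a. *)
Lemma support_point_of_truncation C V a y f : convex_set C -> open V ->
  convex_set V -> V y -> normal_cone (C `&` closure V) a f -> f a < f y ->
  support_points C a.
Proof.
move=> cC oV cV Vy [[Ca clVa] Nf] fay.
have [_ cf] := dualP f.
pose W := V `&` [set x | f a < f x].
have oF : open [set x | f a < f x].
  apply: (open_comp (D := [set r | f a < r])) => [z _|]; first exact: cf.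
  exact: open_gt.
have oW : open W by exact: openI.
have cW : convex_set W.
  apply/convex_setP => u v t t0 t1 [Vu fu] [Vv fv]; split.
    by move/convex_setP: cV; exact.
  by rewrite /= dual_comb; move: fu fv => /=; nra.
have WC0 : W `&` C = set0.
  rewrite -subset0 => x [[Vx /= fx] Cx].
  have : f (x - a) <= 0 by apply: Nf; split=> //; exact: subset_closure.
  by rewrite dualB; lra.
have aW : closure W a.
  move=> B; rewrite nbhsE => -[B' [oB' B'a] B'B].
  have [s [s0 s1 Bs]] := nbhs_ray (y - a) (open_nbhs_nbhs (conj oB' B'a)).
  have as_ : a + s *: (y - a) = s *: y + (1 - s) *: a.
    by rewrite scalerBr scalerBl scale1r addrCA.
  have clVs : closure V (a + s *: (y - a)).
    rewrite as_; have /convex_setP := convex_closure cV; apply=> //.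
    exact: subset_closure.
  have [|z [Vz [B'z fz]]] := clVs (B' `&` [set x | f a < f x]).
    apply: open_nbhs_nbhs; split; first exact: openI.
    by split=> //=; rewrite dual_ray dualB; nra.
  by exists z; split=> //; exact: B'B.
have [g g0 gCW] : exists2 g : topological_dual X, g <> 0 &
    forall c x, C c -> W x -> g c <= g x.
  by apply: convex_separation => //; [exists y|exists a].
apply/support_pointsP; exists g => //; split=> // c Cc.
rewrite dualB subr_le0.
have [_ cg] := dualP g.
have clG : closed [set x | g c <= g x].
  apply: (preimage_closed (D := [set r | g c <= r])) => [z _|]; first exact: cg.
  exact: closed_ge.
by apply: clG; apply: (closureS _ aW) => x; exact: gCW.
Qed.

End locally_convex.

Unset Implicit Arguments.
Set Strict Implicit.

Theorem theorem7 (R : realType) (X : tvsType R)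
    (hausdorffX : hausdorff_space X)
    (nontrivialX : exists x : X, x <> 0) :
  (forall C : set X, C !=set0 -> closed C -> convex_set C ->
     maximal_monotone_op (normal_cone C)) ->
  forall C : set X, closed C -> convex_set C ->
    dense_in (support_points C) (boundary C).
Proof.
move=> maxN C clC cC; split; first exact: support_points_boundary.
move=> x0 [clCx0 nintCx0] B B0.
have Cx0 : C x0 by exact: clC.
have [V [oV cV Vx0 clVB]] := open_convex_nbhs B0.
have [y [Vy nCy]] : exists y, V y /\ ~ C y.
  apply: contrapT => h; apply: nintCx0; rewrite /interior.
  apply: (filterS _ (open_nbhs_nbhs (conj oV Vx0))) => y Vy.
  by apply: contrapT => nCy; apply: h; exists y.
have D0 : (C `&` closure V) !=set0.
  by exists x0; split=> //; exact: subset_closure.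
have clD : closed (C `&` closure V).
  by apply: closedI => //; exact: closed_closure.
have cD : convex_set (C `&` closure V).
  move/convex_setP: cC => cC'; have /convex_setP cV' := convex_closure cV.
  apply/convex_setP => u v t t0 t1 [? ?] [? ?].
  by split; [exact: cC'|exact: cV'].
have nDy : ~ (C `&` closure V) y by case.
have [a [f [Nf fay]]] := maximal_normal_cone (maxN _ D0 clD cD) nDy.
exists a; split; last by case: Nf => -[_ /clVB].
exact: support_point_of_truncation oV cV Vy Nf fay.
Qed.
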